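(* Let $n\geq 2$ be a positive integer. Then $$\det(\mathrm{lcir}(\boldsymbol{c}_n(-1)))=0.$$
   Context: For $\boldsymbol{a}=(a_0,a_1,\dots,a_{n-1})\in\mathbb{C}^n$, $\mathrm{lcir}(\boldsymbol{a})$ denotes the $n\times n$ complex left circulant matrix with first row $\boldsymbol{a}$, each subsequent row being the preceding row rotated one position to the left; i.e., indexing rows and columns by $0,\dots,n-1$, its $(j,k)$ entry is $a_{(j+k)\bmod n}$. For a nonzero complex number $z$, $\boldsymbol{c}_n(z)=\left(\binom{n-1}{0}z^0,\binom{n-1}{1}z^1,\dots,\binom{n-1}{n-1}z^{n-1}\right)\in\mathbb{C}^n$ is the vector of coefficients of $(x+zy)^{n-1}$. *)

(* Defs.v *)
From mathcomp Require Import all_boot all_order all_algebra.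
From mathcomp Require Import reals.
From mathcomp.real_closed Require Import complex.

Set Implicit Arguments.
Unset Strict Implicit.
Unset Printing Implicit Defensive.

Import GRing.Theory.
Local Open Scope ring_scope.
Local Open Scope complex_scope.

Fact add_ord_mod_subproof n (j k : 'I_n) : ((j + k) %% n < n)%N.
Proof. by rewrite ltn_pmod // (leq_ltn_trans _ (ltn_ord j)). Qed.

Definition add_ord_mod n (j k : 'I_n) : 'I_n :=
  Ordinal (add_ord_mod_subproof j k).

Definition lcir (T : Type) n (a : 'rV[T]_n) : 'M[T]_n :=
  \matrix_(j < n, k < n) a 0 (add_ord_mod j k).

(* The coefficients of (x + z y)^(n-1), that of x^(n-1-k) y^k at index k.
   The case z = 0 is harmless and is not excluded. *)
Definition binom_row (R : realType) n (z : R[i]) : 'rV[R[i]]_n :=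
  \row_(k < n) ('C(n.-1, k)%:R * z ^+ k).

(* Main.v *)
(* The all-ones vector lies in the kernel: every column of lcir a sums to the
   sum of the entries of a, which for c_n(-1) is (1 - 1)^(n-1) = 0. *)
Require Import Defs.
From mathcomp Require Import all_boot all_order all_algebra.
From mathcomp Require Import reals.
From mathcomp.real_closed Require Import complex.

Import GRing.Theory.
Local Open Scope ring_scope.
Local Open Scope complex_scope.

(** Each column of [lcir a] permutes the entries of [a], so the all-ones row is a left eigenvector
    with eigenvalue the entry sum. By the binomial theorem this is [(1 + z) ^+ n.-1] for
    [binom_row n z], hence zero at [z = -1]. *)

Lemma sum_add_ord_mod (V : nmodType) n (f : 'I_n -> V) (k : 'I_n) :
  \sum_j f (add_ord_mod j k) = \sum_j f j.
Proof.
case: n f k => [|n] f k; first by case: k.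
(* ['I_n.+1] is the additive group of integers mod [n.+1], where translation by [k] is injective. *)
rewrite [RHS](reindex_inj (addIr k)).
by apply: eq_bigr => j _; congr f; apply: val_inj.
Qed.

Lemma const_mx1_mul_lcir (S : pzSemiRingType) n (a : 'rV[S]_n) :
  const_mx 1 *m lcir a = const_mx (\sum_j a 0 j) :> 'rV_n.
Proof.
apply/rowP => k; rewrite !mxE -[RHS](sum_add_ord_mod _ _ _ k).
by apply: eq_bigr => j _; rewrite !mxE mul1r.
Qed.

Lemma sum_binom_row (R : realType) n (z : R[i]) :
  (0 < n)%N -> \sum_j binom_row n z 0 j = (1 + z) ^+ n.-1.
Proof.
case: n => // n _; rewrite exprDn; apply: eq_bigr => j _.
by rewrite mxE expr1n mul1r mulr_natl.
Qed.

Theorem proposition4p2 (R : realType) (n : nat) (hn : (2 <= n)%N) :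
  \det (lcir (binom_row n (-1 : R[i]))) = 0.
Proof.
apply/eqP/det0P; exists (const_mx 1).
  apply/eqP => /rowP/(_ (Ordinal (ltnW hn))) /eqP.
  by rewrite !mxE oner_eq0.
rewrite const_mx1_mul_lcir sum_binom_row ?(ltnW hn) // subrr expr0n.
(* [2 <= n] makes the exponent [n.-1] positive, excluding [0 ^+ 0 = 1]. *)
by case: n hn => [|[|n]] // _; apply/rowP => j; rewrite !mxE.
Qed.
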